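(* Consider a smooth monotone game with gradient operator $V$ that is $L$-Lipschitz ($L>0$). Let $\mu>0$ and $\eta\in\left(0,\frac{\mu}{(L+\mu)^2}\right)$ be constants and let $\bar c\ge 1$. Then there is a constant $A$, which does not depend on $T$, such that the following holds. For every total number of iterations $T\ge2$ and every $c\in[1,\bar c]$ such that $T_\sigma=c\cdot\max\left(1,\frac{6\ln(3(T+1))}{\ln(1+\eta\mu)}\right)$ is an integer: if all players run GABP with full feedback from any initial profile $\pi^1\in\mathcal{X}$, with perturbation strength $\mu$, constant learning rate $\eta_t=\eta$ and update interval $T_\sigma$, then for every player $i\in[N]$, $$\mathrm{Reg}_i(T)\le\mathrm{DynamicReg}_i(T)\le A\,(\ln T)^2 .$$ That is, $\mathrm{Reg}_i(T)\le\mathrm{DynamicReg}_i(T)\le\mathcal{O}\left((\ln T)^2\right)$.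
   Context: Game. There are $N$ players; player $i\in[N]=\{1,\dots,N\}$ has a nonempty compact convex strategy space $\mathcal{X}_i\subset\mathbb{R}^{d_i}$, and $\mathcal{X}=\prod_{i\in[N]}\mathcal{X}_i$. Player $i$ has a payoff function $v_i:\mathcal{X}\to\mathbb{R}$, differentiable on $\mathcal{X}$, which she wants to maximize. Let $V(\pi)=(\nabla_{\pi_i}v_i(\pi))_{i\in[N]}$. The norm $\|\cdot\|$ is the $\ell_2$-norm. The game is smooth monotone: for all $\pi,\pi'\in\mathcal{X}$, $\langle V(\pi)-V(\pi'),\pi-\pi'\rangle\le 0$ and $\|V(\pi)-V(\pi')\|\le L\|\pi-\pi'\|$. Regrets. With $\pi_{-i}$ denoting the strategies of all players other than $i$, $$\mathrm{Reg}_i(T)=\max_{x\in\mathcal{X}_i}\sum_{t=1}^T\left(v_i(x,\pi_{-i}^t)-v_i(\pi^t)\right),\qquad \mathrm{DynamicReg}_i(T)=\sum_{t=1}^T\left(\max_{x\in\mathcal{X}_i}v_i(x,\pi_{-i}^t)-v_i(\pi^t)\right).$$ GABP (Gradient Ascent with Boosting Payoff Perturbation). Given learning rates $\eta_t>0$, perturbation strength $\mu>0$, a positive integer update interval $T_\sigma$, and initial profile $\pi^1\in\mathcal{X}$, put $k(t)=\lfloor (t-1)/T_\sigma\rfloor+1$ and $\sigma_i^{k}=\pi_i^{T_\sigma(k-1)+1}$ for $k\ge1$ (so $\sigma_i^1=\pi_i^1$). For $t\ge 1$, each player $i$ receives feedback $\widehat\nabla_{\pi_i}v_i(\pi^t)$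 and sets $$\pi_i^{t+1}=\arg\max_{x\in\mathcal{X}_i}\left\{\eta_t\left\langle \widehat\nabla_{\pi_i}v_i(\pi^t)-\mu\frac{\sigma_i^{k(t)}-\sigma_i^1}{k(t)+1}-\mu\left(\pi_i^t-\sigma_i^{k(t)}\right),x\right\rangle-\frac12\|x-\pi_i^t\|^2\right\}.$$ Full feedback means $\widehat\nabla_{\pi_i}v_i(\pi^t)=\nabla_{\pi_i}v_i(\pi^t)$. *)

(* Defs.v *)
From HB Require Import structures.
From mathcomp Require Import all_boot all_order all_algebra.
From mathcomp Require Import all_classical all_reals all_analysis.

Set Implicit Arguments.
Unset Strict Implicit.
Unset Printing Implicit Defensive.

Import Order.TTheory GRing.Theory Num.Theory.
Import numFieldNormedType.Exports.

Local Open Scope classical_set_scope.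
Local Open Scope ring_scope.

Definition dot (R : realType) (n : nat) (u v : 'rV[R]_n) : R :=
  \sum_(j < n) u 0 j * v 0 j.

(* The library norm `|u| on row vectors is the sup norm. *)
Definition l2norm (R : realType) (n : nat) (u : 'rV[R]_n) : R :=
  Num.sqrt (dot u u).

Definition is_argmax (R : realType) (T : Type) (A : set T) (f : T -> R) (x : T)
  : Prop := A x /\ forall y, A y -> f y <= f x.

(* g is a gradient at x of f seen as a function on A: only the values of f on A
   matter, so f need not extend differentiably past the boundary of A. If A is
   convex with nonempty interior there is at most one such g; for a lower
   dimensional A (a simplex, say) g is unique up to a vector orthogonal to the
   affine hull of A. All norms on 'rV_n being equivalent, the sup norm of the
   library may be used in the little-o. *)
Definition is_gradient_on (R : realType) (n : nat) (A : set 'rV[R]_n)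
    (f : 'rV[R]_n -> R) (x g : 'rV[R]_n) : Prop :=
  (fun y => f y - f x - dot g (y - x) : R^o)
    =o_ (within A (nbhs x)) (fun y => y - x).

Definition differentiable_on (R : realType) (n : nat) (A : set 'rV[R]_n)
    (f : 'rV[R]_n -> R) : Prop :=
  forall x, A x -> exists g, is_gradient_on A f x g.

(* R^(d_1) * ... * R^(d_N) is R^(d_1 + ... + d_N); the strategy of player i in
   the profile pi is the block submxrow pi i. *)
Notation profile R N d := 'rV[R]_(\sum_(i < N) d i).

Definition joint (R : realType) (N : nat) (d : 'I_N -> nat)
    (X : forall i : 'I_N, set 'rV[R]_(d i)) : set (profile R N d) :=
  [set pi | forall i, X i (submxrow pi i)].

(* (x, pi_{-i}) *)
Definition deviate (R : realType) (N : nat) (d : 'I_N -> nat)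
    (pi : profile R N d) (i : 'I_N) (x : 'rV[R]_(d i)) : profile R N d :=
  \mxrow_(j < N) eqtype.dfwith (submxrow pi) x j.

(* The payoffs v i are total functions, but only their values on joint X are
   constrained. *)
Record smooth_monotone_game (R : realType) (N : nat) (d : 'I_N -> nat)
    (X : forall i : 'I_N, set 'rV[R]_(d i))
    (v : 'I_N -> profile R N d -> R)
    (V : profile R N d -> profile R N d) (L : R) : Prop := {
  strategies_nonempty : forall i, X i !=set0;
  strategies_compact : forall i, compact (X i);
  strategies_convex : forall i,
    convex_set (X i : set (convex_lmodType 'rV[R]_(d i)));
  payoff_differentiable : forall i, differentiable_on (joint X) (v i);
  payoff_gradient : forall pi, joint X pi -> forall i,
    is_gradient_on (X i) (fun x => v i (deviate pi x))
      (submxrow pi i) (submxrow (V pi) i);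
  gradient_monotone : forall pi pi', joint X pi -> joint X pi' ->
    dot (V pi - V pi') (pi - pi') <= 0;
  gradient_lipschitz : forall pi pi', joint X pi -> joint X pi' ->
    l2norm (V pi - V pi') <= L * l2norm (pi - pi')
}.

(* In both regrets the supremum is a maximum: by differentiability v i is
   continuous on the compact set joint X. *)
Definition regret (R : realType) (N : nat) (d : 'I_N -> nat)
    (X : forall i : 'I_N, set 'rV[R]_(d i)) (v : 'I_N -> profile R N d -> R)
    (pi : nat -> profile R N d) (i : 'I_N) (T : nat) : R :=
  sup [set \sum_(1 <= t < T.+1) (v i (deviate (pi t) x) - v i (pi t))
      | x in X i].

Definition dynamic_regret (R : realType) (N : nat) (d : 'I_N -> nat)
    (X : forall i : 'I_N, set 'rV[R]_(d i)) (v : 'I_N -> profile R N d -> R)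
    (pi : nat -> profile R N d) (i : 'I_N) (T : nat) : R :=
  \sum_(1 <= t < T.+1)
    (sup [set v i (deviate (pi t) x) | x in X i] - v i (pi t)).

Definition phase (Tsigma t : nat) : nat := ((t - 1) %/ Tsigma + 1)%N.

Definition anchor (R : realType) (N : nat) (d : 'I_N -> nat) (Tsigma : nat)
    (pi : nat -> profile R N d) (i : 'I_N) (k : nat) : 'rV[R]_(d i) :=
  submxrow (pi (Tsigma * (k - 1) + 1)%N) i.

(* pi is a run of GABP with feedback ghat; time starts at 1 and pi 0 is not
   used. *)
Definition gabp (R : realType) (N : nat) (d : 'I_N -> nat)
    (X : forall i : 'I_N, set 'rV[R]_(d i)) (eta : nat -> R) (mu : R)
    (Tsigma : nat) (ghat pi : nat -> profile R N d) : Prop :=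
  joint X (pi 1%N) /\
  forall (t : nat) (i : 'I_N), (1 <= t)%N ->
    let k := phase Tsigma t in
    let sigma := anchor Tsigma pi i in
    let pit := submxrow (pi t) i in
    is_argmax (X i)
      (fun x =>
         eta t * dot (submxrow (ghat t) i
                      - (mu / (k + 1)%:R) *: (sigma k - sigma 1%N)
                      - mu *: (pit - sigma k)) x
         - 2^-1 * l2norm (x - pit) ^+ 2)
      (submxrow (pi t.+1) i).

Definition gabp_full_feedback (R : realType) (N : nat) (d : 'I_N -> nat)
    (X : forall i : 'I_N, set 'rV[R]_(d i)) (V : profile R N d -> profile R N d)
    (eta : nat -> R) (mu : R) (Tsigma : nat) (pi : nat -> profile R N d)
  : Prop :=
  gabp X eta mu Tsigma (fun t => V (pi t)) pi.

(* Main.v *)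
(* Within a phase, GABP is projected ascent for the strongly monotone field
   [V p + mu (y_k - p)], where [y_k = (k sigma_k + sigma_1) / (k + 1)]; for
   [eta < mu / (L + mu)^2] its step is a contraction, so that after [Tsigma]
   steps the anchor [sigma_{k+1}] solves the perturbed variational inequality up
   to [O(T^-3)].  The anchors thus follow an inexact Halpern iteration of the
   resolvent of [- V / mu], and a Lyapunov function bounds the residuals
   [y_{k-1} - sigma_k] by [O(1/k)].  Hence the first step of phase [k] has length
   [O(1/k)], and by contraction so have all later ones and the total drift:
   every iterate of phase [k] has gap [O(1/k)] for [V].  Payoffs are concave in
   the own strategy, so the gap dominates the regret of a round, and
   [sum_t 1/k(t) <= Tsigma sum_t 1/t = O((ln T)^2)]. *)
Require Import Defs.
From HB Require Import structures.
From mathcomp Require Import all_boot all_order all_algebra.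
From mathcomp Require Import all_classical all_reals all_analysis.
From mathcomp Require Import ring lra zify.
Set Implicit Arguments.
Unset Strict Implicit.
Unset Printing Implicit Defensive.

Import Order.TTheory GRing.Theory Num.Theory.
Import numFieldNormedType.Exports.
Local Open Scope classical_set_scope.
Local Open Scope ring_scope.

(** * The Euclidean inner product *)

Section Dot.
Context {R : realType} {n : nat}.
Implicit Types u v w : 'rV[R]_n.

Lemma dotC u v : dot u v = dot v u.
Proof. by apply: eq_bigr => j _; rewrite mulrC. Qed.

Lemma dotDl u v w : dot (u + v) w = dot u w + dot v w.
Proof. by rewrite -big_split; apply: eq_bigr => j _; rewrite mxE mulrDl. Qed.

Lemma dotDr u v w : dot u (v + w) = dot u v + dot u w.
Proof. by rewrite dotC dotDl !(dotC _ u). Qed.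

Lemma dotZl a u v : dot (a *: u) v = a * dot u v.
Proof. by rewrite mulr_sumr; apply: eq_bigr => j _; rewrite mxE mulrA. Qed.

Lemma dotZr a u v : dot u (a *: v) = a * dot u v.
Proof. by rewrite dotC dotZl dotC. Qed.

Lemma dotNl u v : dot (- u) v = - dot u v.
Proof. by rewrite -scaleN1r dotZl mulN1r. Qed.

Lemma dotNr u v : dot u (- v) = - dot u v.
Proof. by rewrite dotC dotNl dotC. Qed.

Lemma dot0l u : dot 0 u = 0.
Proof. by rewrite -(scale0r u) dotZl mul0r. Qed.

Definition dotE := (dotDl, dotDr, dotNl, dotNr, dotZl, dotZr).

Lemma dot_ge0 u : 0 <= dot u u.
Proof. by apply: sumr_ge0 => j _; rewrite -expr2 sqr_ge0. Qed.

Lemma l2norm_ge0 u : 0 <= l2norm u.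
Proof. exact: sqrtr_ge0. Qed.

Lemma sqr_l2norm u : l2norm u ^+ 2 = dot u u.
Proof. by rewrite sqr_sqrtr // dot_ge0. Qed.

Lemma l2norm0_eq0 u : l2norm u = 0 -> u = 0.
Proof.
move=> u0; apply/rowP => j; rewrite mxE; apply/eqP; rewrite -sqrf_eq0 expr2.
move: (sqr_l2norm u); rewrite u0 expr0n /= => /esym/eqP.
rewrite psumr_eq0 => [/allP|i _]; last by rewrite -expr2 sqr_ge0.
by apply; rewrite mem_index_enum.
Qed.

Lemma cauchy_schwarz u v : dot u v <= l2norm u * l2norm v.
Proof.
have [nu0|nu0] := eqVneq (l2norm u) 0.
  by rewrite nu0 mul0r (l2norm0_eq0 nu0) dot0l.
have [nv0|nv0] := eqVneq (l2norm v) 0.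
  by rewrite nv0 mulr0 (l2norm0_eq0 nv0) dotC dot0l.
have pu : 0 < l2norm u by rewrite lt_def nu0 l2norm_ge0.
have pv : 0 < l2norm v by rewrite lt_def nv0 l2norm_ge0.
have := dot_ge0 (l2norm v *: u - l2norm u *: v).
rewrite !dotE -!sqr_l2norm (dotC v u).
set a := l2norm u in pu *; set b := l2norm v in pv *; set c := dot u v => H.
have : 0 <= 2 * (a * b) * (a * b - c) by apply: le_trans H _; lra.
by rewrite pmulr_rge0 ?subr_ge0 // !mulr_gt0.
Qed.

Lemma l2normN u : l2norm (- u) = l2norm u.
Proof. by rewrite /l2norm dotNl dotNr opprK. Qed.

Lemma l2normB u v : l2norm (u - v) = l2norm (v - u).
Proof. by rewrite -l2normN opprB. Qed.

Lemma l2normZ a u : l2norm (a *: u) = `|a| * l2norm u.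
Proof. by rewrite /l2norm dotZl dotZr mulrA -expr2 sqrtrM ?sqr_ge0 ?sqrtr_sqr. Qed.

Lemma ler_l2normD u v : l2norm (u + v) <= l2norm u + l2norm v.
Proof.
rewrite -(@ler_pXn2r _ 2) ?nnegrE ?addr_ge0 ?l2norm_ge0 // sqr_l2norm sqrrD.
by rewrite !dotE (dotC v u) !sqr_l2norm; have := cauchy_schwarz u v; lra.
Qed.

Lemma l2norm_triangle v u w : l2norm (u - w) <= l2norm (u - v) + l2norm (v - w).
Proof. by rewrite -[u - w](subrKA v) ler_l2normD. Qed.

Lemma dot_ge_l2norm u v : - (l2norm u * l2norm v) <= dot u v.
Proof. by have := cauchy_schwarz (- u) v; rewrite dotNl l2normN; lra. Qed.

End Dot.

(** * Inexact Halpern iteration *)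

(* Halpern iteration [x_{k+1} = (k x_k + x_1) / (k+1) - g_{k+1}] along a
   monotone field: [k^2/2 |g_k|^2 + k <g_k, x_k - x_1>] increases by at most
   [k (k+1) e] per step, [e] being the defect of monotonicity. *)
Lemma halpern_potential (R : realType) (n K : nat) (x g : nat -> 'rV[R]_n)
    (e : R) :
  0 <= e ->
  (forall k, (1 <= k)%N ->
     k.+1%:R *: x k.+1 = k%:R *: x k + x 1%N - k.+1%:R *: g k.+1) ->
  (forall k, (2 <= k)%N -> (k < K)%N ->
     - e <= dot (g k.+1 - g k) (x k.+1 - x k)) ->
  forall k, (2 <= k)%N -> (k <= K)%N ->
    k%:R ^+ 2 / 2 * dot (g k) (g k) + k%:R * dot (g k) (x k - x 1%N)
      <= k%:R * (K%:R * K%:R * e).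
Proof.
move=> e0 xE mono; elim=> // k IH; case: (ltngtP k 1%N) => [|k1 _ kK|-> _ K2].
- by case: k IH.
- have := IH k1 (ltnW kK); have := mono _ k1 kK; have := xE _ (ltnW k1).
  set y := x k.+1; set h := g k.+1.
  have -> : k.+1%:R = k%:R + 1 :> R by rewrite -natr1.
  have : 1 <= k%:R :> R by rewrite ler1n ltnW.
  have : k%:R + 1 <= K%:R :> R by rewrite natr1 ler_nat.
  set m : R := k%:R; set M : R := K%:R; move=> mM m1 yE mon ih.
  have Eh : (m + 1) * dot h y
      = m * dot h (x k) + dot h (x 1%N) - (m + 1) * dot h h.
    by rewrite -dotZr yE !dotE.
  have Eg : (m + 1) * dot (g k) y
      = m * dot (g k) (x k) + dot (g k) (x 1%N) - (m + 1) * dot (g k) h.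
    by rewrite -dotZr yE !dotE.
  have sq : 0 <= dot ((m + 1) *: h - m *: g k) ((m + 1) *: h - m *: g k).
    exact: dot_ge0.
  have mon' : - (m * (m + 1) * e)
      <= m * ((m + 1) * dot (h - g k) (y - x k)) by nra.
  have eM : m * (m + 1) * e <= M * M * e.
    by apply: ler_wpM2r => //; apply: ler_pM; lra.
  move: sq mon' ih; rewrite !dotE (dotC (g k) h).
  set a := dot h h; set b := dot h (g k); set c := dot (g k) (g k).
  move: Eh Eg; rewrite (dotC (g k) h) -/a -/b.
  set hy := dot h y; set hx := dot h (x k); set h1 := dot h (x 1%N).
  set gy := dot (g k) y; set gx := dot (g k) (x k); set g1 := dot (g k) (x 1%N).
  move=> Eh Eg sq mon' ih.
  have Ehy : m * ((m + 1) * hy) = m * (m * hx + h1 - (m + 1) * a) by rewrite Eh.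
  have Ehx : (m + 1) * ((m + 1) * hy)
    = (m + 1) * (m * hx + h1 - (m + 1) * a) by rewrite Eh.
  have Egy : m * ((m + 1) * gy) = m * (m * gx + g1 - (m + 1) * b) by rewrite Eg.
  lra.
- have g2 : 2%:R *: g 2%N = 2%:R *: (x 1%N - x 2%N).
    rewrite [RHS]scalerBr xE //= scale1r; apply/rowP => j; rewrite !mxE; ring.
  have {}g2 : g 2%N = x 1%N - x 2%N.
    by apply: scalerI g2; rewrite pnatr_eq0.
  have -> : x 2%N - x 1%N = - g 2%N by rewrite g2 opprB.
  rewrite dotNr; have : 0 <= K%:R * K%:R * e by rewrite !mulr_ge0.
  lra.
Qed.

(** If [u > a + b], then [u ^+ 2 > (a + b) * u >= a ^+ 2 + b * u]. Both [O(1/k)] bounds below come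
    out of a quadratic inequality of this shape. *)
Lemma le_of_sqr_le (R : realType) (u a b : R) :
  0 <= a -> 0 <= b -> u ^+ 2 <= a ^+ 2 + b * u -> u <= a + b.
Proof. by move=> a0 b0 H; rewrite leNgt; apply/negP => ?; nra. Qed.

(** * Perturbed projected ascent *)

(** The two perturbation terms of GABP merge into one attraction to a single center [a]: the mean of
    the current anchor and the initial profile with weights [k] and [1]. *)
Definition pull {R : realType} {n : nat} (V : 'rV[R]_n -> 'rV[R]_n) (mu : R)
    (a p : 'rV[R]_n) : 'rV[R]_n := V p + mu *: (a - p).

(* The variational inequality characterising [q] as the Euclidean projection
   of [p + eta *: F p] on the convex set [X]. *)
Definition proj_step {R : realType} {n : nat} (X : set 'rV[R]_n) (eta : R)
    (F : 'rV[R]_n -> 'rV[R]_n) (p q : 'rV[R]_n) : Prop :=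
  X q /\ forall x, X x -> dot (p + eta *: F p - q) (x - q) <= 0.

Section PerturbedAscent.
Context {R : realType} {n : nat} {X : set 'rV[R]_n}.
Context {V : 'rV[R]_n -> 'rV[R]_n} {L mu eta D : R}.
Hypothesis L_gt0 : 0 < L.
Hypothesis mu_gt0 : 0 < mu.
Hypothesis eta_bnd : 0 < eta < mu / (L + mu) ^+ 2.
Hypothesis D_ge0 : 0 <= D.
Hypothesis V_mono : forall p q, X p -> X q -> dot (V p - V q) (p - q) <= 0.
Hypothesis V_lip : forall p q, X p -> X q ->
  l2norm (V p - V q) <= L * l2norm (p - q).
Hypothesis diam : forall p q, X p -> X q -> l2norm (p - q) <= D.

Local Notation step a := (proj_step X eta (pull V mu a)).
Let r := Num.sqrt (1 - eta * mu).

Lemma eta_gt0 : 0 < eta. Proof. by case/andP: eta_bnd. Qed.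

Lemma eta_sqr_lt : eta * (L + mu) ^+ 2 < mu.
Proof.
case/andP: eta_bnd => _; rewrite ltr_pdivlMr // exprn_gt0 // addr_gt0 //.
Qed.

Lemma eta_mu_lt1 : eta * mu < 1.
Proof.
have H := eta_sqr_lt; have e0 := eta_gt0.
have m0 := mu_gt0; have l0 := L_gt0.
have H2 : eta * mu * mu < 1 * mu.
  rewrite mul1r; apply: le_lt_trans H; rewrite -mulrA ler_pM2l // expr2.
  by apply: ler_pM; lra.
by rewrite ltr_pM2r in H2.
Qed.

Lemma rate_gt0 : 0 < r.
Proof. by rewrite sqrtr_gt0 subr_gt0 eta_mu_lt1. Qed.

Lemma sqr_rate : r ^+ 2 = 1 - eta * mu.
Proof. by rewrite sqr_sqrtr // subr_ge0 ltW // eta_mu_lt1. Qed.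

Lemma rate_lt1 : r < 1.
Proof.
have := sqr_rate; have := rate_gt0; have := mulr_gt0 eta_gt0 mu_gt0.
move=> em r0 H; rewrite ltNge; apply/negP => ?; nra.
Qed.

(** Adding the two variational inequalities gives [|y|^2 <= <z, y>] with [z] the difference of the
    unprojected points, hence [|y| <= |z|]. In [|z|^2] monotonicity discards the cross term and the
    Lipschitz bound leaves the factor [(1 - eta mu)^2 + eta^2 L^2], at most [1 - eta mu] because
    [eta (L + mu)^2 < mu]. *)
Lemma step_contract a p q p' q' : X p -> X p' -> step a p q -> step a p' q' ->
  l2norm (q - q') <= r * l2norm (p - p').
Proof.
move=> Xp Xp' [Xq vq] [Xq' vq'].
have := vq _ Xq'; have := vq' _ Xq.
have VM := V_mono Xp Xp'; have VL := V_lip Xp Xp'.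
set u := p - p' in VM VL *; set w := V p - V p' in VM VL *.
set y := q - q' => h1 h2.
have hy : dot y y <= dot ((1 - eta * mu) *: u + eta *: w) y.
  rewrite -subr_ge0 -dotNl -dotDl.
  have -> : (1 - eta * mu) *: u + eta *: w - y =
      (p + eta *: pull V mu a p - q) - (p' + eta *: pull V mu a p' - q').
    by rewrite /u /w /y /pull; apply/rowP => j; rewrite !mxE; ring.
  rewrite dotDl dotNl; move: h2; rewrite -(opprB q q') dotNr -/y; lra.
set z := (1 - eta * mu) *: u + eta *: w in hy.
have zy : 0 <= dot (z - y) (z - y) by exact: dot_ge0.
have hz : dot y y <= dot z z.
  by move: (z) (y) zy hy => z' y'; rewrite !dotE (dotC y' z'); lra.
have ww : dot w w <= L ^+ 2 * dot u u.
  rewrite -!sqr_l2norm -exprMn ler_pXn2r // nnegrE ?l2norm_ge0 //.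
  by rewrite mulr_ge0 ?l2norm_ge0 // ltW.
rewrite -(@ler_pXn2r _ 2) ?nnegrE ?mulr_ge0 ?l2norm_ge0 ?(ltW rate_gt0) //.
rewrite exprMn sqr_rate !sqr_l2norm; apply: le_trans hz _.
rewrite /z; clearbody u w; rewrite !dotE (dotC u w).
have := dot_ge0 u; have := eta_gt0; have := eta_mu_lt1; have := eta_sqr_lt.
move: VM ww; set a1 := dot w u; set a2 := dot w w; set a3 := dot u u.
move=> VM ww e1 e2 e3 a30.
have k1 : (1 - eta * mu) * eta * a1 <= 0.
  by rewrite pmulr_rle0 // mulr_gt0 // subr_gt0.
have k2 : eta * eta * a2 <= eta * eta * (L ^+ 2 * a3).
  by rewrite ler_pM2l // mulr_gt0.
have k3 : 0 <= eta * a3 * (mu - eta * (L + mu) ^+ 2).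
  by apply: mulr_ge0; [apply: mulr_ge0 => //; exact: ltW | rewrite subr_ge0 ltW].
have k4 : 0 <= eta * eta * (L * mu) * a3.
  by apply: mulr_ge0 => //; apply: ltW; rewrite !mulr_gt0.
lra.
Qed.

Let kappa := eta * (L + mu) + 1.

Lemma kappa_gt0 : 0 < kappa.
Proof. by rewrite ltr_wpDl // mulr_ge0 ?addr_ge0 ?ltW ?eta_gt0. Qed.

(** The projection inequality involves [p + eta *: pull V mu a p - q] instead of the field at [q];
    the discrepancy is of the order of the step length. *)
Lemma step_gap a p q x : X p -> X x -> step a p q ->
  eta * dot (pull V mu a q) (x - q) <= kappa * l2norm (q - p) * D.
Proof.
move=> Xp Xx [Xq /(_ _ Xx) vq].
have -> : eta * dot (pull V mu a q) (x - q) =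
    dot (p + eta *: pull V mu a p - q) (x - q)
    + eta * dot (V q - V p) (x - q) + (1 - eta * mu) * dot (q - p) (x - q).
  rewrite /pull -!dotZl -!dotDl; congr (dot _ _).
  by apply/rowP => j; rewrite !mxE; ring.
have := diam Xx Xq; have := V_lip Xq Xp.
have := cauchy_schwarz (V q - V p) (x - q).
have := cauchy_schwarz (q - p) (x - q).
have := l2norm_ge0 (x - q); have := l2norm_ge0 (q - p).
have := l2norm_ge0 (V q - V p).
set m := l2norm (V q - V p); set d := l2norm (q - p); set e := l2norm (x - q).
move=> m0 d0 e0 c1 c2 ml eD.
have de : d * e <= d * D by rewrite ler_wpM2l.
have me : m * e <= L * (d * D).
  rewrite mulrA; apply: ler_pM => //.
have := eta_gt0; have em := mulr_gt0 eta_gt0 mu_gt0; have := eta_mu_lt1.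
move=> em1 et0.
have k1 : eta * dot (V q - V p) (x - q) <= eta * (L * (d * D)).
  by rewrite ler_pM2l //; lra.
have k2 : (1 - eta * mu) * dot (q - p) (x - q) <= (1 - eta * mu) * (d * D).
  by rewrite ler_pM2l ?subr_gt0 //; lra.
have k3 : 0 <= eta * mu * (d * D).
  by apply: mulr_ge0; [exact: ltW | exact: mulr_ge0].
rewrite /kappa; lra.
Qed.

Lemma iter_step_decay a (w : nat -> 'rV[R]_n) m : X (w 0%N) ->
  (forall j, (j < m)%N -> step a (w j) (w j.+1)) ->
  forall j, (j < m)%N ->
    l2norm (w j.+1 - w j) <= r ^+ j * l2norm (w 1%N - w 0%N).
Proof.
move=> X0 st; elim=> [|j IH] jm; first by rewrite expr0 mul1r.
have Xw i : (i <= m)%N -> X (w i) by case: i => // i im; have [] := st _ im.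
have jm' := ltnW jm.
apply: le_trans (step_contract (Xw _ jm') (Xw _ (ltnW jm'))
  (st _ jm) (st _ jm')) _.
by rewrite exprS -mulrA ler_pM2l ?rate_gt0 // IH.
Qed.

Lemma iter_step_drift a (w : nat -> 'rV[R]_n) m : X (w 0%N) ->
  (forall j, (j < m)%N -> step a (w j) (w j.+1)) ->
  forall j, (j <= m)%N ->
    l2norm (w j - w 0%N) <= l2norm (w 1%N - w 0%N) / (1 - r).
Proof.
move=> X0 st j jm; set u := l2norm (w 1%N - w 0%N).
have u0 : 0 <= u by exact: l2norm_ge0.
have r1 : 0 < 1 - r by rewrite subr_gt0 rate_lt1.
(* Strengthened to the partial sum of the geometric series, so that the induction closes. *)
suff H : l2norm (w j - w 0%N) <= u * (1 - r ^+ j) / (1 - r).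
  apply: le_trans H _; rewrite ler_pM2r ?invr_gt0 // ler_piMr //.
  by rewrite gerBl exprn_ge0 // ltW // rate_gt0.
elim: j jm => [|j IH] jm.
  by rewrite subrr expr0 subrr mulr0 mul0r /l2norm dot0l sqrtr0.
apply: le_trans (l2norm_triangle (w j) _ _) _.
have := iter_step_decay X0 st jm; have := IH (ltnW jm).
rewrite -/u => h1 h2; apply: le_trans (lerD h2 h1) _.
rewrite -(ler_pM2r r1) mulrDl !divfK ?gt_eqF // exprS.
by rewrite le_eqVlt; apply/orP; left; apply/eqP; ring.
Qed.


(** * Anchors of a run as an inexact Halpern iteration *)

Section Run.
Context {B : R} {Ts T : nat} {p : nat -> 'rV[R]_n}.
Hypothesis V_bnd : forall x, X x -> l2norm (V x) <= B.
Hypothesis Ts_gt0 : (0 < Ts)%N.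
Hypothesis rate_Ts : r ^+ Ts <= (T.+1%:R ^+ 3)^-1.

Let s k := p (Ts * (k - 1) + 1)%N.
Let y k := k.+1%:R^-1 *: (k%:R *: s k + s 1%N).
Hypothesis X_start : X (p 1%N).
Hypothesis p_step : forall t, (1 <= t)%N -> step (y (phase Ts t)) (p t) (p t.+1).
(** For [k >= 2], up to the inexactness of phase [k - 1], [mu *: g k] lies in [- V (s k)] plus the
    normal cone of [X] at [s k]: [g] samples a monotone operator along the anchors. *)
Let g k := y k.-1 - s k.
Let E := kappa * D ^+ 2 / r.

Lemma X_run t : (1 <= t)%N -> X (p t).
Proof. by case: t => // -[|t] _ //; have [] := p_step (ltn0Sn t). Qed.

Lemma X_anchor k : X (s k).
Proof. by apply: X_run; rewrite addn1. Qed.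

Lemma phaseE k j : (1 <= k)%N -> (j < Ts)%N ->
  phase Ts (Ts * (k - 1) + 1 + j) = k.
Proof.
move=> k1 jT; rewrite /phase addnAC addnK mulnC divnMDl // divn_small //.
by rewrite addn0 subnK.
Qed.

Lemma run_step k j : (1 <= k)%N -> (j < Ts)%N ->
  step (y k) (p (Ts * (k - 1) + 1 + j)) (p (Ts * (k - 1) + 1 + j.+1)).
Proof.
move=> k1 jT; have t1 : (1 <= Ts * (k - 1) + 1 + j)%N by rewrite addnAC addn1.
by have := p_step t1; rewrite phaseE // (addnS _ j).
Qed.

Lemma gap_const_ge0 : 0 <= E.
Proof.
by rewrite /E divr_ge0 ?mulr_ge0 ?sqr_ge0 ?(ltW kappa_gt0) ?(ltW rate_gt0).
Qed.

(** The anchor [s k.+1] is the endpoint of the last step of phase [k], whose length is geometrically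
    small; [step_gap] converts length into gap. *)
Lemma anchor_gap k x : (1 <= k)%N -> X x ->
  eta * dot (pull V mu (y k) (s k.+1)) (x - s k.+1) <= E / T.+1%:R ^+ 3.
Proof.
move=> k1 Xx; pose w j := p (Ts * (k - 1) + 1 + j)%N.
have sE : s k.+1 = w Ts.
  by rewrite /s /w !subn1 /= addnAC -mulnSr prednK.
have st j : (j < Ts)%N -> step (y k) (w j) (w j.+1) by exact: run_step.
have Xw j : X (w j) by apply: X_run; rewrite addnAC addn1.
have Tp : (Ts.-1 < Ts)%N by rewrite prednK.
have := iter_step_decay (Xw 0%N) st Tp; have := st _ Tp.
rewrite prednK // -sE => st1 dec.
apply: le_trans (step_gap (Xw _) Xx st1) _.
have d0 := diam (Xw 1%N) (Xw 0%N).
(* Only [Ts.-1] contractions precede the last step, hence the [r] in the denominator of [E]. *)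
have rT : r ^+ Ts.-1 <= (T.+1%:R ^+ 3)^-1 / r.
  by rewrite ler_pdivlMr ?rate_gt0 // -exprSr prednK.
have dist : l2norm (s k.+1 - w Ts.-1) <= (T.+1%:R ^+ 3)^-1 / r * D.
  apply: le_trans dec _; apply: ler_pM => //; last exact: l2norm_ge0.
  by rewrite exprn_ge0 // ltW // rate_gt0.
have -> : E / T.+1%:R ^+ 3 = kappa * ((T.+1%:R ^+ 3)^-1 / r * D) * D.
  by rewrite /E; ring.
by rewrite ler_wpM2r // ler_pM2l // kappa_gt0.
Qed.

Lemma anchor_rec k : (1 <= k)%N ->
  k.+1%:R *: s k.+1 = k%:R *: s k + s 1%N - k.+1%:R *: g k.+1.
Proof.
move=> k1; rewrite /g /= scalerBr /y scalerA divff ?pnatr_eq0 // scale1r.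
by rewrite opprB addrC subrK.
Qed.

(** Test the inequality of [s k.+1] at [s k] and conversely, and add the monotonicity of [V]: the
    values of [V] cancel. The index starts at 2 because [s 1], the initial profile, is not the
    output of a phase. *)
Lemma defect_monotone k : (2 <= k)%N ->
  - (2 * E / (eta * mu) / T.+1%:R ^+ 3)
    <= dot (g k.+1 - g k) (s k.+1 - s k).
Proof.
move=> k2.
have h1 := anchor_gap (ltnW k2) (X_anchor k).
have : (1 <= k.-1)%N by case: k k2 {h1} => [|[|]].
move=> /anchor_gap /(_ (X_anchor k.+1)); rewrite prednK ?(ltnW k2) // => h2.
have h3 := V_mono (X_anchor k.+1) (X_anchor k).
have em := mulr_gt0 eta_gt0 mu_gt0.
have -> : 2 * E / (eta * mu) / T.+1%:R ^+ 3
  = (2 * (E / T.+1%:R ^+ 3)) / (eta * mu) by rewrite mulrAC !mulrA.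
rewrite lerNl ler_pdivlMr //.
have h4 : eta * dot (V (s k.+1) - V (s k)) (s k.+1 - s k) <= 0.
  by rewrite pmulr_rle0 // eta_gt0.
suff -> : - dot (g k.+1 - g k) (s k.+1 - s k) * (eta * mu) =
    eta * dot (pull V mu (y k) (s k.+1)) (s k - s k.+1)
    + eta * dot (pull V mu (y k.-1) (s k)) (s k.+1 - s k)
    + eta * dot (V (s k.+1) - V (s k)) (s k.+1 - s k).
  by rewrite mulr_natl mulr2n -[leRHS]addr0 !lerD.
rewrite /g /pull /= -(opprB (s k.+1) (s k)).
set a := s k.+1; set b := s k; rewrite dotNr.
move: (y k) (y k.-1) (V a) (V b) (a - b) => y1 y2 Va Vb ab.
by rewrite !dotE; ring.
Qed.

Let G := Num.sqrt (2 * (2 * E / (eta * mu))) + 2 * D.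

Lemma residual_const_ge0 : 0 <= G.
Proof. by rewrite addr_ge0 ?sqrtr_ge0 // mulr_ge0. Qed.

(** By the Halpern potential and Cauchy-Schwarz, [z = k |g k|] satisfies [z^2 <= 2 S + 2 D z]; [G]
    bounds the solutions. *)
Lemma residual_bound k : (2 <= k)%N -> (k <= T.+1)%N ->
  l2norm (g k) <= G / k%:R.
Proof.
move=> k2 kT; have k0 : 0 < k%:R :> R by rewrite ltr0n ltnW.
have em := mulr_gt0 eta_gt0 mu_gt0; have e0 := gap_const_ge0.
rewrite /G; set S := 2 * E / (eta * mu).
have S0 : 0 <= S by apply: divr_ge0; [exact: mulr_ge0 | exact: ltW].
have T0 : 0 < T.+1%:R ^+ 3 :> R by rewrite exprn_gt0 // ltr0n.
have eT : 0 <= S / T.+1%:R ^+ 3 by rewrite divr_ge0 // ltW.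
have := @halpern_potential R n T.+1 s g _ eT anchor_rec
  (fun k h _ => defect_monotone h) k k2 kT.
(* The potential amplifies the defect by at most [k (T + 1)^2 <= (T + 1)^3]; this is why a phase
   must reach cubic accuracy. *)
have bd : k%:R * (T.+1%:R * T.+1%:R * (S / T.+1%:R ^+ 3)) <= S.
  have -> : k%:R * (T.+1%:R * T.+1%:R * (S / T.+1%:R ^+ 3))
     = k%:R * T.+1%:R ^+ 2 * S / T.+1%:R ^+ 3 :> R by ring.
  rewrite ler_pdivrMr // mulrC ler_wpM2l // (exprSr _ 2) (mulrC k%:R).
  by rewrite ler_pM2l ?exprn_gt0 ?ltr0n // ler_nat.
move=> /le_trans -/(_ _ bd); rewrite -sqr_l2norm.
have := dot_ge_l2norm (g k) (s k - s 1%N).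
have := diam (X_anchor k) (X_anchor 1%N); have := l2norm_ge0 (g k).
set a := l2norm (g k); set d := l2norm _; set c := dot _ _.
move=> a0 dD cd H; rewrite ler_pdivlMr // mulrC.
apply: le_of_sqr_le; rewrite ?sqrtr_ge0 ?mulr_ge0 //.
have S2 : 0 <= 2 * S by exact: mulr_ge0.
rewrite sqr_sqrtr //.
have h1 : k%:R * (- (a * D)) <= k%:R * c.
  rewrite ler_pM2l //; apply: le_trans cd; rewrite lerN2.
  by rewrite ler_wpM2l.
rewrite exprMn; lra.
Qed.

Lemma pull_center_dist k : (1 <= k)%N -> l2norm (y k - s k) <= D / k%:R.
Proof.
move=> k1; have -> : y k - s k = k.+1%:R^-1 *: (s 1%N - s k).
  apply: (@scalerI _ _ k.+1%:R); first by rewrite pnatr_eq0.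
  rewrite /y scalerBr !scalerA divff ?pnatr_eq0 // !scale1r.
  by rewrite -natr1 scalerDl scale1r opprD addrACA subrr add0r.
rewrite l2normZ ger0_norm ?invr_ge0 // mulrC.
apply: ler_pM; rewrite ?l2norm_ge0 ?invr_ge0 ?diam //; try exact: X_anchor.
by rewrite lef_pV2 ?posrE ?ltr0n // ler_nat.
Qed.

Let H := Num.sqrt E + eta * mu * (D + G).

(** Phase [k] starts at [s k], a near solution for the old center [y k.-1]. Testing its inequality
    at [q] and that of the projection at [s k] gives [|q - s k|^2 <= E / k^2 + eta mu <y k - y k.-1,
    q - s k>], and the center has moved by [O(1/k)] only. *)
Lemma first_step_bound k : (2 <= k)%N -> (k <= T.+1)%N ->
  l2norm (p (Ts * (k - 1) + 1 + 1)%N - s k) <= H / k%:R.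
Proof.
move=> k2 kT; have k1 := ltnW k2.
have k0 : 0 < k%:R :> R by rewrite ltr0n.
have em := mulr_gt0 eta_gt0 mu_gt0; have e0 := gap_const_ge0.
have := run_step k1 Ts_gt0; rewrite addn0 -/(s k).
set q := p _ => -[Xq /(_ _ (X_anchor k)) vq].
have : (1 <= k.-1)%N by case: k k2 {k1 kT k0 q Xq vq} => [|[|]].
move=> /anchor_gap /(_ Xq); rewrite prednK // => h1.
have h2 : l2norm (y k - y k.-1) <= (D + G) / k%:R.
  have -> : y k - y k.-1 = (y k - s k) - g k.
    by rewrite /g opprB subrKA.
  apply: le_trans (ler_l2normD _ _) _; rewrite l2normN mulrDl.
  by apply: lerD; [exact: pull_center_dist | exact: residual_bound].
have h3 := cauchy_schwarz (y k - y k.-1) (q - s k).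
set u := l2norm (q - s k) in h3 *.
have u0 : 0 <= u by exact: l2norm_ge0.
have eT : E / T.+1%:R ^+ 3 <= E / k%:R ^+ 2.
  rewrite ler_wpM2l // lef_pV2 ?posrE ?exprn_gt0 ?ltr0n //.
  rewrite -!natrX ler_nat; apply: (@leq_trans (T.+1 ^ 2)%N).
    by rewrite leq_exp2r.
  by rewrite leq_pexp2l.
have -> : H / k%:R = Num.sqrt E / k%:R + eta * mu * ((D + G) / k%:R).
  by rewrite /H mulrDl !mulrA.
apply: le_of_sqr_le.
- by rewrite divr_ge0 ?sqrtr_ge0 // ltW.
- exact: mulr_ge0 (ltW em) (divr_ge0 (addr_ge0 D_ge0 residual_const_ge0) (ltW k0)).
rewrite [u ^+ 2]sqr_l2norm expr_div_n sqr_sqrtr //.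
have h4 : eta * mu * dot (y k - y k.-1) (q - s k)
    <= eta * mu * ((D + G) / k%:R) * u.
  rewrite -[leRHS]mulrA ler_pM2l //; apply: le_trans h3 _.
  by rewrite ler_wpM2r.
have h5 : dot (q - s k) (q - s k) =
   dot (s k + eta *: pull V mu (y k) (s k) - q) (s k - q)
   + eta * dot (pull V mu (y k.-1) (s k)) (q - s k)
   + eta * mu * dot (y k - y k.-1) (q - s k).
  rewrite /pull -(opprB q (s k)) dotNr -dotNl -!dotZl -!dotDl.
  by congr (dot _ _); apply/rowP => j; rewrite !mxE; ring.
by rewrite h5 -[E / _]add0r !lerD // (le_trans h1 eT).
Qed.

(** The gap for [V] is that of the pulled field less [mu <y k - p t.+1, x - p t.+1>]. The former is
    controlled by the step length, the latter by the distance from center to anchor plus the drift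
    within the phase. *)
Lemma run_gap t x : (1 <= t)%N -> (t <= T)%N -> X x ->
  dot (V (p t.+1)) (x - p t.+1) <=
    (B * D + (kappa * H * D + eta * mu * (D + H / (1 - r)) * D) / eta)
      / (phase Ts t)%:R.
Proof.
move=> t1 tT Xx; set k := phase Ts t.
have k1 : (1 <= k)%N by rewrite /k /phase addn1.
have et0 := eta_gt0; have em := mulr_gt0 eta_gt0 mu_gt0.
have k0 : 0 < k%:R :> R by rewrite ltr0n.
have r1 : 0 < 1 - r by rewrite subr_gt0 rate_lt1.
have H0 : 0 <= H.
  apply: addr_ge0 (sqrtr_ge0 _) (mulr_ge0 (ltW em) _).
  exact: addr_ge0 D_ge0 residual_const_ge0.
have B0 : 0 <= B by apply: le_trans (V_bnd Xx); exact: l2norm_ge0.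
set C := kappa * H * D + _.
have C0 : 0 <= C.
  apply: addr_ge0; apply: mulr_ge0 D_ge0; apply: mulr_ge0.
  - exact: ltW kappa_gt0.
  - exact: H0.
  - exact: ltW em.
  - exact: addr_ge0 D_ge0 (divr_ge0 H0 (ltW r1)).
have BD0 : 0 <= B * D by rewrite mulr_ge0.
have Xt : X (p t.+1) by exact: X_run.
(* The first phase has no earlier center to compare with; as [k = 1] there, the trivial bound
   [B * D] serves. *)
have [k2|] := leqP 2 k; last first.
  rewrite ltnS => k1'; have -> : k = 1%N by apply/eqP; rewrite eqn_leq k1'.
  rewrite divr1; apply: le_trans (cauchy_schwarz _ _) _.
  apply: (@le_trans _ _ (B * D)); last by rewrite lerDl divr_ge0 // ltW.
  by apply: ler_pM; rewrite ?l2norm_ge0 ?V_bnd ?diam.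
have kT : (k <= T.+1)%N.
  rewrite /k /phase addn1 ltnS; apply: leq_trans (leq_div _ _) _.
  by rewrite leq_subLR (leq_trans tT) // leq_addl.
(* Round [t] is the step from [w j] to [w j.+1]; if [j.+1 = Ts], its endpoint is the next anchor,
   still counted with phase [k]. *)
pose j := ((t - 1) %% Ts)%N; have jT : (j < Ts)%N by rewrite ltn_mod.
have tE : t = (Ts * (k - 1) + 1 + j)%N.
  rewrite /k /phase addnK addnAC mulnC -divn_eq subnK //.
pose w j := p (Ts * (k - 1) + 1 + j)%N.
have st i : (i < Ts)%N -> step (y k) (w i) (w i.+1) by exact: run_step.
have Xw i : X (w i) by apply: X_run; rewrite addnAC addn1.
have w0E : w 0%N = s k by rewrite /w addn0.
have ptE : p t.+1 = w j.+1 by rewrite /w (addnS _ j) -tE.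
have fs := first_step_bound k2 kT; rewrite -/(w 1%N) -w0E in fs.
have dec := iter_step_decay (Xw 0%N) st jT.
have dr := iter_step_drift (Xw 0%N) st jT.
have gap := step_gap (Xw _) Xx (st _ jT).
rewrite -ptE in dec dr gap.
set u := l2norm (w 1%N - w 0%N) in fs dec dr.
have u0 : 0 <= u by exact: l2norm_ge0.
have dec' : l2norm (p t.+1 - w j) <= H / k%:R.
  apply: le_trans fs; apply: le_trans dec _; rewrite ler_piMl //.
  by apply: exprn_ile1; rewrite ltW // ?rate_gt0 // rate_lt1.
have far : l2norm (y k - p t.+1) <= (D + H / (1 - r)) / k%:R.
  apply: le_trans (l2norm_triangle (s k) _ _) _; rewrite mulrDl.
  apply: lerD; first exact: pull_center_dist.
  rewrite l2normB -w0E; apply: le_trans dr _.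
  by rewrite mulrAC ler_pM2r ?invr_gt0.
have cs := dot_ge_l2norm (y k - p t.+1) (x - p t.+1).
have dx := diam Xx Xt.
have h1 : l2norm (y k - p t.+1) * l2norm (x - p t.+1)
    <= (D + H / (1 - r)) / k%:R * D.
  by apply: ler_pM; rewrite ?l2norm_ge0.
have h2 : kappa * l2norm (p t.+1 - w j) * D <= kappa * (H / k%:R) * D.
  by rewrite ler_wpM2r // ler_pM2l // kappa_gt0.
have h3 : - (eta * mu * dot (y k - p t.+1) (x - p t.+1))
    <= eta * mu * ((D + H / (1 - r)) / k%:R * D).
  by rewrite -mulrN ler_pM2l //; lra.
rewrite ler_pdivlMr //.
apply: (@le_trans _ _ (C / eta)); last by rewrite lerDr.
rewrite ler_pdivlMr // mulrAC -ler_pdivlMr // mulrC.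
move: gap; rewrite /pull dotDl dotZl => gap.
have -> : C / k%:R = kappa * (H / k%:R) * D
   + eta * mu * ((D + H / (1 - r)) / k%:R * D) by rewrite /C mulrDl; ring.
lra.
Qed.

End Run.

(** Fixes the constant before [Ts], [T] and the run, as the uniformity of the final bound
    demands. *)
Lemma run_gap_uniform (B : R) : (forall x, X x -> l2norm (V x) <= B) ->
  exists2 C, 0 <= C & forall (Ts T : nat) (p : nat -> 'rV[R]_n),
    (0 < Ts)%N -> Num.sqrt (1 - eta * mu) ^+ Ts <= (T.+1%:R ^+ 3)^-1 ->
    X (p 1%N) ->
    (forall t, (1 <= t)%N -> step
       ((phase Ts t).+1%:R^-1 *:
          ((phase Ts t)%:R *: p (Ts * (phase Ts t - 1) + 1)%N + p 1%N))
       (p t) (p t.+1)) ->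
    forall t x, (1 <= t)%N -> (t <= T)%N -> X x ->
      dot (V (p t.+1)) (x - p t.+1) <= C / (phase Ts t)%:R.
Proof.
(* The constant is read off from [run_gap] by unification; its absolute value supplies the sign. *)
move=> V_bnd; suff [C HC] : exists C : R, forall (Ts T : nat) (p : nat -> 'rV[R]_n),
    (0 < Ts)%N -> r ^+ Ts <= (T.+1%:R ^+ 3)^-1 -> X (p 1%N) ->
    (forall t, (1 <= t)%N -> step
       ((phase Ts t).+1%:R^-1 *:
          ((phase Ts t)%:R *: p (Ts * (phase Ts t - 1) + 1)%N + p 1%N))
       (p t) (p t.+1)) ->
    forall t x, (1 <= t)%N -> (t <= T)%N -> X x ->
      dot (V (p t.+1)) (x - p t.+1) <= C / (phase Ts t)%:R.
  exists `|C| => // Ts T p Ts0 rate X1 st t x t1 tT Xx.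
  apply: le_trans (HC _ _ _ Ts0 rate X1 st t x t1 tT Xx) _.
  by rewrite ler_wpM2r ?invr_ge0 // ler_norm.
eexists => Ts T p Ts0 rate X1 st t x t1 tT Xx.
apply: (run_gap V_bnd Ts0 rate X1 _ t1 tT Xx) => u u1.
by have := st u u1; rewrite subnn muln0.
Qed.

End PerturbedAscent.

(** * Strategy profiles and payoffs *)

(** First-order optimality along the segment from [q] to [x]: comparing [q] with the point at
    fraction [l] and dividing by [l] gives [a <= l * b / 2], impossible for small [l] if [a > 0]. *)
Lemma argmax_proj (R : realType) (n : nat) (X : set 'rV[R]_n) (eta : R)
    (F p q : 'rV[R]_n) :
  (forall x y l, X x -> X y -> 0 < l <= 1 -> X (x + l *: (y - x))) ->
  is_argmax X (fun x => eta * dot F x - 2^-1 * l2norm (x - p) ^+ 2) q ->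
  forall x, X x -> dot (p + eta *: F - q) (x - q) <= 0.
Proof.
move=> cX [Xq maxq] x Xx; rewrite leNgt; apply/negP => a0.
set a := dot _ _ in a0; set b := dot (x - q) (x - q).
have b0 : 0 <= b by exact: dot_ge0.
have key l : 0 < l <= 1 -> a <= l * b / 2.
  move=> l1; have /andP[l0 _] := l1.
  have := maxq _ (cX _ _ _ Xq Xx l1); rewrite !sqr_l2norm -subr_ge0.
  have -> : q + l *: (x - q) - p = (q - p) + l *: (x - q) by rewrite addrAC.
  have aE : a = eta * dot F (x - q) - dot (q - p) (x - q).
    by rewrite -dotZl -dotNl -dotDl /a; congr (dot _ _); rewrite opprB addrCA addrA.
  move=> H; rewrite -subr_ge0 -(pmulr_rge0 _ l0); apply: le_trans H _.
  rewrite le_eqVlt; apply/orP; left; apply/eqP.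
  rewrite aE /b; move: (x - q) (q - p) => z w.
  by rewrite !dotE (dotC z w); field.
(* This fraction lies in []0, 1]] even if [b = 0], and [l * b <= a] turns [key] into
   [a <= a / 2]. *)
have := key (a / (a + b)); have ab : 0 < a + b by exact: ltr_wpDr.
rewrite divr_gt0 // ler_pdivrMr // mul1r lerDl b0 => /(_ isT).
have : a / (a + b) * b <= a by rewrite mulrAC ler_pdivrMr // ler_pM2l //; lra.
lra.
Qed.

Section Profiles.
Context {R : realType} {N : nat} {d : 'I_N -> nat}.
Implicit Types (pi u w : profile R N d).

Lemma dot_blocks u w :
  dot u w = \sum_(i < N) dot (submxrow u i) (submxrow w i).
Proof.
have dotM m (a b : 'rV[R]_m) : dot a b = (a *m b^T) 0 0.
  by rewrite mxE; apply: eq_bigr => j _; rewrite !mxE.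
rewrite dotM -{1}[u]submxrowK -{1}[w]submxrowK tr_mxrow mul_mxrow_mxcol.
by rewrite summxE; apply: eq_bigr => i _; rewrite dotM.
Qed.

Lemma submxrow_deviate pi i x : submxrow (deviate pi x) i = x.
Proof. by rewrite mxrowK dfwith_in. Qed.

Lemma submxrow_deviate_out pi i (x : 'rV[R]_(d i)) j :
  i != j -> submxrow (deviate pi x) j = submxrow pi j.
Proof. by move=> ij; rewrite mxrowK dfwith_out. Qed.

Lemma deviate_id pi i : deviate pi (submxrow pi i) = pi.
Proof.
apply/mxrowP => j; have [<-|ij] := eqVneq i j; first exact: submxrow_deviate.
exact: submxrow_deviate_out.
Qed.

Lemma deviate_deviate pi i (x y : 'rV[R]_(d i)) :
  deviate (deviate pi x) y = deviate pi y.
Proof.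
apply/mxrowP => j; have [<-|ij] := eqVneq i j; first by rewrite !submxrow_deviate.
by rewrite !submxrow_deviate_out.
Qed.

Lemma joint_deviate (X : forall i, set 'rV[R]_(d i)) pi i x :
  joint X pi -> X i x -> joint X (deviate pi x).
Proof.
move=> Xpi Xx j; have [<-|ij] := eqVneq i j; first by rewrite submxrow_deviate.
by rewrite submxrow_deviate_out.
Qed.

Lemma dot_deviateB u pi i (x y : 'rV[R]_(d i)) :
  dot u (deviate pi x - deviate pi y) = dot (submxrow u i) (x - y).
Proof.
rewrite dot_blocks (bigD1 i) //= submxrowB !submxrow_deviate big1 ?addr0 //.
by move=> j ji; rewrite submxrowB !submxrow_deviate_out 1?eq_sym // subrr dotC dot0l.
Qed.

Lemma submxrowZ a u i : submxrow (a *: u) i = a *: submxrow u i.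
Proof. by apply/rowP => j; rewrite !mxE. Qed.

End Profiles.

Lemma convex_set_segment (R : realType) (n : nat) (X : set 'rV[R]_n) :
  convex_set (X : set (convex_lmodType 'rV[R]_n)) ->
  forall x y l, X x -> X y -> 0 <= l <= 1 -> X (x + l *: (y - x)).
Proof.
move=> cX x y l /mem_set Xx /mem_set Xy /andP[l0 l1].
have /set_mem := cX y x (Itv01 l0 l1) Xy Xx.
rewrite /conv /= => H; suff -> : x + l *: (y - x) = l *: y + (1 - l) *: x by [].
by rewrite scalerBl scale1r scalerBr addrCA.
Qed.

(** * The gradient inequality on a convex set *)

Section GradientInequality.
Context {R : realType} {n : nat} {X : set 'rV[R]_n} {f : 'rV[R]_n -> R}.
Context {G : 'rV[R]_n -> 'rV[R]_n}.
Hypothesis X_seg : forall (x y : 'rV[R]_n) (l : R), X x -> X y -> 0 <= l <= 1 ->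
  X (x + l *: (y - x)).
Hypothesis f_grad : forall x, X x -> is_gradient_on X f x (G x).

Let line (q x : 'rV[R]_n) (l : R) : 'rV[R]_n := q + l *: (x - q).

(** The little-o of the relative gradient, pulled back to the segment. Keeping the filter within
    [[0, 1]] covers the endpoints, where the information is one-sided. *)
Lemma near_line q x (l e : R) : X q -> X x -> 0 <= l <= 1 -> 0 < e ->
  \forall y \near within `[0, 1] (nbhs l),
    `|f (line q x y) - f (line q x l) - (y - l) * dot (G (line q x l)) (x - q)|
      <= e * `|y - l|.
Proof.
move=> Xq Xx l01 e0.
(* The added [1] keeps the divisor positive when [x = q]. *)
have z0 : 0 < `|x - q| + 1 by rewrite ltr_pwDr.
have /eqoP/(_ (e / (`|x - q| + 1))) := f_grad (X_seg Xq Xx l01).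
rewrite divr_gt0 // => /(_ isT) H.
have cont : line q x y @[y --> l] --> line q x l.
  by apply: cvgD; [exact: cvg_cst | apply: cvgZr_tmp; exact: cvg_id].
apply: (@filterS _ (nbhs l) _ _ _ _ (cont _ H)) => y /= Hy y01.
have /Hy {Hy} : X (line q x y).
  by apply: X_seg => //; move: y01; rewrite /= in_itv.
have -> : line q x y - line q x l = (y - l) *: (x - q).
  by rewrite /line opprD addrACA subrr add0r -scalerBl.
rewrite dotZr normrZ => /le_trans; apply.
rewrite -mulrA ler_pM2l // mulrCA ler_piMr // mulrC.
by rewrite ler_pdivrMr // mul1r lerDl.
Qed.

Hypothesis G_mono : forall x y, X x -> X y -> dot (G x - G y) (x - y) <= 0.

(** Mean value theorem on the segment from [q] to [x]; by [G_mono] the slope at the intermediate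
    point is at most the slope at [q]. *)
Lemma gradient_inequality q x : X q -> X x -> f x - f q <= dot (G q) (x - q).
Proof.
move=> Xq Xx; pose phi l := f (line q x l).
pose dphi l := dot (G (line q x l)) (x - q).
have der (l : R) : l \in `]0, 1[ -> is_derive l 1 phi (dphi l).
  rewrite in_itv /= => /andP[l0 l1].
  suff : h^-1 *: ((phi \o shift l) (h *: 1) - phi l) @[h --> 0^'] --> dphi l.
    by move=> cv; apply: DeriveDef; [apply/cvg_ex; exists (dphi l) | exact/cvg_lim].
  apply/cvgrPdist_le => e e0.
  have l01 : 0 <= l <= 1 by rewrite !ltW.
  have H := near_line Xq Xx l01 e0.
  have H1 : \forall y \near l, y \in `[0, 1].
    have : \forall y \near l, y \in `]0, 1[.
      by apply: near_in_itvoo; rewrite in_itv /= l0.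
    by apply: filterS => y; exact: subset_itv_oo_cc.
  have H2 : \forall h \near (0 : R), (h + l) \in `[0, 1] /\
    `|phi (h + l) - phi l - (h + l - l) * dphi l| <= e * `|h + l - l|.
    have : h + l @[h --> (0 : R)] --> (0 + l).
      by apply: cvgD; [exact: cvg_id | exact: cvg_cst].
    rewrite add0r => cv.
    apply: (@filterS _ (nbhs (0 : R)) _ _ _ _ (cv _ (filterI H1 H))).
    by move=> h /= [h1 h2]; split=> //; exact: h2.
  near=> h.
  have h0 : h != 0 by near: h; exact: nbhs_dnbhs_neq.
  have [_] : (h + l) \in `[0, 1] /\
    `|phi (h + l) - phi l - (h + l - l) * dphi l| <= e * `|h + l - l|.
    by near: h; exact: nbhs_dnbhs H2.
  rewrite addrK /= => H3.
  have ah : 0 < `|h| by rewrite normr_gt0.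
  rewrite distrC -(ler_pM2r ah) -normrM mulrBl [h%:A]mulr1.
  by rewrite [_ *: _]mulrC mulfVK // mulrC in H3 *.
(* At every point, endpoints included, [near_line] with [e = 1] gives a Lipschitz estimate at [l]
   with constant [1 + |dphi l|]. *)
have cont : {within `[0, 1], continuous phi}.
  apply/subspace_continuousP => l l01; apply/cvgrPdist_le => e e0.
  have l01' : 0 <= l <= 1 by move: l01; rewrite /= in_itv.
  near=> y.
  have : `|phi y - phi l - (y - l) * dphi l| <= 1 * `|y - l|.
    by near: y; exact: near_line.
  have : (1 + `|dphi l|) * `|y - l| <= e.
    near: y; apply: cvg_within.
    have b0 : 0 < 1 + `|dphi l| by rewrite ltr_wpDr.
    have /cvgrPdist_le/(_ _ (divr_gt0 e0 b0)) : y @[y --> (l : R)] --> (l : R).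
      exact: cvg_id.
    by apply: filterS => y; rewrite ler_pdivlMr // mulrC distrC.
  rewrite mulrDl mul1r -normrM [`|phi l - _|]distrC => h1 h2.
  apply: le_trans h1; rewrite -lerBlDr.
  apply: le_trans h2; rewrite lerBlDr mulrC.
  by apply: le_trans (ler_normD _ _); rewrite subrK.
have [c c01] := MVT ltr01 der cont.
have -> : phi 1 = f x by rewrite /phi /line scale1r addrC subrK.
have -> : phi 0 = f q by rewrite /phi /line scale0r addr0.
rewrite subr0 mulr1 => ->.
move: c01; rewrite in_itv /= => /andP[c0 c1].
have Xc : X (line q x c) by apply: X_seg => //; rewrite !ltW.
have cE : line q x c - q = c *: (x - q) by rewrite /line addrC addKr.
have := G_mono Xc Xq; rewrite cE dotZr pmulr_rle0 //.
by rewrite dotDl dotNl subr_le0.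
Unshelve. all: by end_near.
Qed.

End GradientInequality.

(** * From the game to the projected iteration *)

Section Game.
Context {R : realType} {N : nat} {d : 'I_N -> nat}.
Context {X : forall i : 'I_N, set 'rV[R]_(d i)}.
Arguments X : clear implicits.
Context {v : 'I_N -> profile R N d -> R} {V : profile R N d -> profile R N d}.
Context {L : R}.
Hypothesis game : smooth_monotone_game X v V L.
Implicit Types pi : profile R N d.

(** Restricted to profiles that differ only in block [i], monotonicity of [V] becomes monotonicity
    of the partial gradient, that is, concavity of the payoff in the own strategy. *)
Lemma payoff_gap pi i (x : 'rV[R]_(d i)) : joint X pi -> X i x ->
  v i (deviate pi x) - v i pi <= dot (V pi) (deviate pi x - pi).
Proof.
move=> Xpi Xx; pose G (y : 'rV[R]_(d i)) := submxrow (V (deviate pi y)) i.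
have Xd (y : 'rV[R]_(d i)) : X i y -> joint X (deviate pi y) by exact: joint_deviate.
have grad (y : 'rV[R]_(d i)) : X i y ->
    is_gradient_on (X i) (fun z => v i (deviate pi z)) y (G y).
  move=> Xy; have := payoff_gradient game (Xd _ Xy) i.
  rewrite submxrow_deviate; congr is_gradient_on.
  by apply/funext => z; rewrite deviate_deviate.
have mono (y z : 'rV[R]_(d i)) : X i y -> X i z -> dot (G y - G z) (y - z) <= 0.
  move=> Xy Xz; rewrite -submxrowB -(dot_deviateB _ pi).
  exact: (gradient_monotone game (Xd _ Xy) (Xd _ Xz)).
have seg := convex_set_segment (@strategies_convex _ _ _ _ _ _ _ game i).
have := gradient_inequality seg grad mono (Xpi i) Xx.
by rewrite /G -(dot_deviateB _ pi) !deviate_id.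
Qed.

Lemma joint_diameter :
  exists2 D, 0 <= D & forall pi pi', joint X pi -> joint X pi' ->
    l2norm (pi - pi') <= D.
Proof.
have /choice[M HM] i : exists M, forall x, X i x -> `|x| <= M.
  have [M [_ HM]] := compact_bounded (@strategies_compact _ _ _ _ _ _ _ game i).
  by exists (M + 1) => x Xx; apply: (HM (M + 1)); rewrite ?ltrDl.
(* Block [i] has [d i] coordinates, each differing by at most [2 M i] since the library norm is the
   sup norm. *)
exists (Num.sqrt (\sum_i (d i)%:R * (M i + M i) ^+ 2)); first exact: sqrtr_ge0.
move=> pi pi' Xpi Xpi'; apply: ler_wsqrtr; rewrite dot_blocks.
apply: ler_sum => i _; rewrite submxrowB.
set u := submxrow pi i - _.
have uM : `|u| <= M i + M i.
  by apply: le_trans (ler_normB _ _) _; apply: lerD; apply: HM.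
rewrite -[d i in leRHS]card_ord mulr_natl -sumr_const; apply: ler_sum => j _.
rewrite -expr2 -real_normK ?num_real // ler_pXn2r ?nnegrE //.
  apply: le_trans uM; rewrite [leRHS]/Num.norm /= mx_normrE.
  by apply/bigmax_geP; right; exists (0, j).
exact: le_trans uM.
Qed.

(** The players' separate variational inequalities add up to one on the joint set. *)
Lemma gabp_proj_step eta mu Ts (p : nat -> profile R N d) :
  gabp_full_feedback X V (fun=> eta) mu Ts p -> forall t, (1 <= t)%N ->
  proj_step (joint X) eta
    (pull V mu ((phase Ts t).+1%:R^-1 *:
       ((phase Ts t)%:R *: p (Ts * (phase Ts t - 1) + 1)%N + p 1%N)))
    (p t) (p t.+1).
Proof.
move=> [_ run] t t1; have {}run i := run t i t1.
split=> [i|x Xx]; first by have [] := run i.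
rewrite dot_blocks; apply: sumr_le0 => i _.
have seg (x' y' : 'rV[R]_(d i)) (l : R) :
    X i x' -> X i y' -> 0 < l <= 1 -> X i (x' + l *: (y' - x')).
  move=> Xx' Xy' /andP[/ltW l0 l1].
  apply: (convex_set_segment (@strategies_convex _ _ _ _ _ _ _ game i)) => //.
  by rewrite l0.
have := argmax_proj seg (run i) (Xx i).
rewrite !(submxrowB, submxrowD, submxrowZ); congr (dot (_ + _ *: _ - _) _ <= 0).
rewrite /pull /anchor subnn muln0.
apply/rowP => j; rewrite !mxE -natr1 natrD; field.
by rewrite natr1 pnatr_eq0.
Qed.

Lemma deviation_bound B D pi i (x : 'rV[R]_(d i)) :
  (forall p, joint X p -> l2norm (V p) <= B) ->
  (forall p q, joint X p -> joint X q -> l2norm (p - q) <= D) ->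
  joint X pi -> X i x -> v i (deviate pi x) <= v i pi + B * D.
Proof.
move=> V_bnd diam Xpi Xx; rewrite -lerBlDl.
apply: le_trans (payoff_gap Xpi Xx) _; apply: le_trans (cauchy_schwarz _ _) _.
apply: ler_pM; rewrite ?l2norm_ge0 ?V_bnd ?diam //; exact: joint_deviate.
Qed.

End Game.

(** * Summation over the rounds *)

Lemma harmonic_le_ln (R : realType) (n : nat) : (1 <= n)%N ->
  \sum_(1 <= t < n.+1) t%:R^-1 <= 1 + ln n%:R :> R.
Proof.
elim: n => // -[_ _|n IH _]; first by rewrite big_nat1 invr1 ln1 addr0.
rewrite big_nat_recr //=; have {}IH := IH isT.
(* [ln (1 + x) <= x] at [x = - 1/(n+2)] gives [1/(n+2) <= ln (n+2) - ln (n+1)]. *)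
have h : - n.+2%:R^-1 > -1 :> R by rewrite ltrN2 invf_lt1 ?ltr1n // ltr0n.
have := le_ln1Dx h.
have -> : 1 - n.+2%:R^-1 = n.+1%:R / n.+2%:R :> R.
  have -> : n.+1%:R = n.+2%:R - 1 :> R by rewrite -[n.+2%:R]natr1 addrK.
  by rewrite mulrBl divff ?pnatr_eq0 // mul1r.
rewrite ln_div ?posrE ?ltr0n // lerBlDr => step.
apply: le_trans (lerD IH (lexx _)) _.
by rewrite -addrA lerD2l -lerBrDr addrC.
Qed.

(** The interval is long enough for the accuracy of a phase, yet short enough to cost a single
    logarithm. *)
Lemma interval_length_bounds (R : realType) (c cbar b : R) (T Ts : nat) :
  0 < b -> (2 <= T)%N -> 1 <= c <= cbar ->
  Ts%:R = c * Num.max 1 (6 * ln (3 * (T + 1)%:R) / b) ->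
  6 * ln (T.+1%:R : R) <= Ts%:R * b /\
  1 <= (Ts%:R : R) <= cbar * ((ln 2)^-1 + 24 / b) * ln T%:R.
Proof.
move=> b0 T2 /andP[c1 cc]; set l3 := ln (3 * _); set M := Num.max _ _ => TsE.
have T0 := ltnW T2.
have ln2 : 0 < ln 2 :> R by rewrite ln_gt0 // ltr1n.
have lnT : ln 2 <= ln T%:R :> R by rewrite ler_ln ?posrE ?ltr0n // ler_nat.
have l31 : ln T.+1%:R <= l3.
  rewrite /l3 ler_ln ?posrE ?mulr_gt0 ?ltr0n ?addn1 //.
  by rewrite ler_peMl // ler1n.
(* [3 (T + 1) <= T^4] from [T = 2] on; this makes the constant [24 = 6 * 4]. *)
have l34 : l3 <= 4 * ln T%:R.
  rewrite mulr_natl -lnXn ?ltr0n // /l3.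
  rewrite ler_ln ?posrE ?mulr_gt0 ?exprn_gt0 ?ltr0n ?addn1 //.
  rewrite -natrX -natrM ler_nat.
  have T3 : (2 ^ 3 <= T ^ 3)%N by rewrite leq_exp2r.
  by rewrite expnS; nia.
have l30 : 0 <= l3 by apply: le_trans l31; rewrite ln_ge0 // ler1n.
have M1 : 1 <= M by rewrite le_max lexx.
have M2 : 6 * l3 / b <= M by rewrite le_max lexx orbT.
have M3 : M <= 1 + 6 * l3 / b.
  by rewrite ge_max lerDl lerDr ler01 divr_ge0 ?mulr_ge0 // ltW.
have cM : M <= c * M by rewrite ler_peMl // (le_trans _ M1).
have McM : c * M <= cbar * M by rewrite ler_wpM2r // (le_trans _ M1).
split.
  rewrite TsE; apply: (@le_trans _ _ (M * b)); last by rewrite ler_pM2r.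
  by rewrite -ler_pdivrMr //; apply: le_trans M2; rewrite ler_pM2r ?invr_gt0 //; lra.
rewrite TsE (le_trans M1 cM) /=; apply: le_trans McM _.
rewrite -mulrA ler_wpM2l //; first by apply: le_trans cc; lra.
apply: le_trans M3 _; rewrite [leRHS]mulrDl; apply: lerD.
  by rewrite mulrC ler_pdivlMr // mul1r.
by rewrite [leRHS]mulrAC ler_pM2r ?invr_gt0 //; lra.
Qed.

(** Squaring removes the root, and [(1 - a) (1 + a) <= 1] turns the rate into [(1 + a)^-Ts]; the [6]
    in the interval length is thus twice the exponent [3]. *)
Lemma rate_power_le (R : realType) (a : R) (T Ts : nat) :
  0 < a -> a < 1 -> 6 * ln T.+1%:R <= Ts%:R * ln (1 + a) ->
  Num.sqrt (1 - a) ^+ Ts <= (T.+1%:R ^+ 3)^-1.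
Proof.
move=> a0 a1 H; have T0 : 0 < T.+1%:R :> R by rewrite ltr0n.
rewrite -(@ler_pXn2r _ 2) ?nnegrE ?exprn_ge0 ?invr_ge0 ?sqrtr_ge0 ?exprn_ge0 //.
rewrite -exprM mulnC exprM sqr_sqrtr ?subr_ge0 ?(ltW a1) // exprVn -exprM.
have pow : T.+1%:R ^+ 6 <= (1 + a) ^+ Ts.
  rewrite -ler_ln ?posrE ?exprn_gt0 ?addr_gt0 // !lnXn ?addr_gt0 //.
  by rewrite -(mulr_natl _ 6) -(mulr_natl _ Ts).
apply: (@le_trans _ _ ((1 + a) ^+ Ts)^-1).
  rewrite -exprVn; apply: lerXn2r; rewrite ?nnegrE ?invr_ge0; try lra.
  by rewrite -[_^-1]mul1r ler_pdivlMr; [nra | lra].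
by rewrite lef_pV2 ?posrE ?exprn_gt0 // addr_gt0.
Qed.

(** Trades [1 / phase] for [Ts / t], so that the sum over rounds becomes harmonic. *)
Lemma leq_mul_phase (Ts t : nat) :
  (0 < Ts)%N -> (0 < t)%N -> (t <= phase Ts t * Ts)%N.
Proof.
by move=> Ts0 t0; rewrite -[t in leqLHS](subnK t0) /phase !addn1 ltn_ceil.
Qed.

Lemma regret_le_dynamic_regret (R : realType) (N : nat) (d : 'I_N -> nat)
    (X : forall i : 'I_N, set 'rV[R]_(d i)) (v : 'I_N -> profile R N d -> R)
    (p : nat -> profile R N d) (i : 'I_N) (T : nat) :
  X i !=set0 ->
  (forall t, (1 <= t)%N -> has_ubound [set v i (deviate (p t) x) | x in X i]) ->
  regret X v p i T <= dynamic_regret X v p i T.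
Proof.
move=> [x0 Xx0] bnd; apply: ge_sup; first by eexists; exists x0.
move=> _ [x Xx <-]; apply: ler_sum_nat => t /andP[t1 _]; rewrite lerD2r.
by apply: ub_le_sup; [exact: bnd | exists x].
Qed.

Theorem theorem5p1 (R : realType) (N : nat) (d : 'I_N -> nat)
    (X : forall i : 'I_N, set 'rV[R]_(d i))
    (v : 'I_N -> profile R N d -> R)
    (V : profile R N d -> profile R N d)
    (L mu eta cbar : R) :
  0 < L ->
  smooth_monotone_game X v V L ->
  0 < mu ->
  0 < eta < mu / (L + mu) ^+ 2 ->
  1 <= cbar ->
  exists A : R,
    forall (T : nat) (c : R) (Tsigma : nat) (pi : nat -> profile R N d),
      (2 <= T)%N ->
      1 <= c <= cbar ->
      Tsigma%:R
        = c * Num.max 1 (6 * ln (3 * (T + 1)%:R) / ln (1 + eta * mu)) ->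
      gabp_full_feedback X V (fun=> eta) mu Tsigma pi ->
      forall i : 'I_N,
        regret X v pi i T <= dynamic_regret X v pi i T /\
        dynamic_regret X v pi i T <= A * ln (T%:R) ^+ 2.
Proof.
move=> L0 game mu0 eta_bnd cbar1.
have [/andP[eta0 _] etamu1] := (eta_bnd, eta_mu_lt1 L0 mu0 eta_bnd).
have em0 : 0 < eta * mu by exact: mulr_gt0.
have [D D0 diam] := joint_diameter game.
have [[p0 Xp0]|Xempty] := pselect (exists p0, joint X p0); last first.
  exists 0 => T c Ts p _ _ _ [Xp1 _].
  by exfalso; apply: Xempty; exists (p 1%N).
pose B := L * D + l2norm (V p0).
have V_bnd p : joint X p -> l2norm (V p) <= B.
  move=> Xp; rewrite -[V p](subrK (V p0)).
  apply: le_trans (ler_l2normD _ _) _; rewrite lerD2r.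
  apply: le_trans (gradient_lipschitz game Xp Xp0) _.
  by rewrite ler_pM2l ?diam.
have BD0 : 0 <= B * D.
  by rewrite mulr_ge0 ?addr_ge0 ?mulr_ge0 ?l2norm_ge0 // ltW.
have [C C0 HC] := run_gap_uniform L0 mu0 eta_bnd D0
  (@gradient_monotone _ _ _ _ _ _ _ game)
  (@gradient_lipschitz _ _ _ _ _ _ _ game) diam V_bnd.
set b := ln (1 + eta * mu).
have b0 : 0 < b by rewrite ln_gt0 // ltrDl.
pose C1 := cbar * ((ln 2)^-1 + 24 / b).
(* The first summand pays for round one, the second for the others: [C * Ts * (1 + ln T)] with
   [Ts <= C1 * ln T]. The inverse powers of [ln 2] absorb constants, as [ln T >= ln 2]. *)
exists (B * D / (ln 2) ^+ 2 + C * C1 * ((ln 2)^-1 + 1)).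
move=> T c Ts p T2 c_bnd TsE run i.
have [rate /andP[Ts1 TsC]] := interval_length_bounds b0 T2 c_bnd TsE.
have Ts0 : (0 < Ts)%N by rewrite -(ltr0n R) (lt_le_trans _ Ts1).
have [X1 _] := run.
have stp := gabp_proj_step game run.
have Xp t : (1 <= t)%N -> joint X (p t).
  by case: t => // -[|t] _ //; have [] := stp _ (ltn0Sn t).
have ne := @strategies_nonempty _ _ _ _ _ _ _ game i.
split.
  apply: regret_le_dynamic_regret => // t t1; exists (v i (p t) + B * D).
  by move=> _ [x Xx <-]; exact: (deviation_bound game V_bnd diam (Xp _ t1) Xx).
have gap := HC Ts T p Ts0 (rate_power_le em0 etamu1 rate) X1 stp.
have ln2 : 0 < ln 2 :> R by rewrite ln_gt0 // ltr1n.
have lnT : ln 2 <= ln T%:R :> R.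
  by rewrite ler_ln ?posrE ?ltr0n ?(ltnW T2) // ler_nat.
(* Gaps are bounded at [p t.+1] for [1 <= t] only, so round one is split off. *)
rewrite /dynamic_regret big_nat_recl ?(ltnW T2) //.
set u := ln T%:R in lnT TsC *.
have one_le : 1 <= u / ln 2 by rewrite ler_pdivlMr // mul1r.
rewrite mulrDl; apply: lerD.
  apply: (@le_trans _ _ (B * D)).
    rewrite lerBlDl; case: ne => x0 Xx0; apply: ge_sup; first by eexists; exists x0.
    by move=> _ [x Xx <-]; exact: (deviation_bound game V_bnd diam X1 Xx).
  rewrite -mulrA ler_peMr // mulrC -expr_div_n.
  by rewrite exprn_ege1.
have bound t : (1 <= t < T)%N ->
    sup [set v i (deviate (p t.+1) x) | x in X i] - v i (p t.+1)
      <= C * Ts%:R * t%:R^-1.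
  move=> /andP[t1 tT]; rewrite lerBlDl; case: ne => x0 Xx0.
  apply: ge_sup; first by eexists; exists x0.
  move=> _ [x Xx <-]; rewrite -lerBlDl.
  apply: le_trans (payoff_gap game (Xp _ (ltn0Sn t)) Xx) _.
  apply: le_trans (gap _ _ t1 (ltnW tT) _) _.
    exact: joint_deviate (Xp _ (ltn0Sn t)) Xx.
  rewrite -mulrA ler_wpM2l // -[leRHS]invf_div lef_pV2 ?posrE ?divr_gt0 ?ltr0n //.
    by rewrite ler_pdivrMr ?ltr0n // -natrM ler_nat leq_mul_phase.
  by rewrite /phase addn1.
apply: le_trans (ler_sum_nat bound) _; rewrite -mulr_sumr.
have harm : \sum_(1 <= t < T) t%:R^-1 <= 1 + u.
  case: T T2 {c_bnd TsE rate gap bound TsC} @u lnT one_le => // T T1 u _ _.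
  apply: le_trans (harmonic_le_ln R T1) _.
  by rewrite lerD2l ler_ln ?posrE ?ltr0n // ler_nat.
apply: (@le_trans _ _ (C * (C1 * u) * (1 + u))).
  apply: ler_pM harm; [exact: mulr_ge0 | | exact: ler_wpM2l].
  by apply: sumr_ge0 => t _; rewrite invr_ge0.
have -> : C * C1 * ((ln 2)^-1 + 1) * u ^+ 2 = C * (C1 * u) * (u / ln 2 + u).
  by ring.
rewrite ler_wpM2l ?lerD2r // mulr_ge0 // (le_trans _ TsC) //.
Qed.
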